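(* For $n\ge 1$, $a_n(12;2\to 2)=n!-d_n$, where $d_n$ is the $n$-th derangement number.
   Context: Standard cycle form of $\sigma\in S_n$: product of disjoint cycles (fixed points included), each cycle starting with its largest element, cycles listed in increasing order of largest elements. The fundamental bijection $\theta:S_n\to S_n$ erases the parentheses of the standard cycle form to give a one-line permutation. For $\pi\in S_n$, $\hat\pi=\theta^{-1}(\pi)$. An arrow pattern $(\nu;H)$ of size $k$: a string $\nu=a_1\dots a_m$ of positive integers and a set $H$ of arrows $b\to c$, with all integers appearing forming $[k]$. $\pi\in S_n$ contains $(\nu;H)$ if there is $X=\{x_1<\dots<x_k\}\subseteq[n]$ with positions $t_1<\dots<t_m$ such that $\pi_{t_1}\cdots\pi_{t_m}=x_{a_1}\cdots x_{a_m}$ and $\hat\pi(x_b)=x_c$ for every arrow $b\to c\in H$; otherwise it avoids it. $a_n(\nu;H)$ = number of $\pi\in S_n$ avoiding $(\nu;H)$. $d_n$ = number of fixed-point-free permutations of $[n]$. So $(12;2\to2)$ is the size-2 pattern: $x_1<x_2$ with $x_1$ appearing before $x_2$ in $\pi$ and $\hat\pi(x_2)=x_2$. *)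

(* Defs.v *)
From mathcomp Require Import all_boot perm.
Set Implicit Arguments.
Unset Strict Implicit.
Unset Printing Implicit Defensive.

(* [n] and [k] are represented by 'I_n and 'I_k, so that values, positions and
   pattern letters are all shifted down by one.  The one-line notation of
   pi : 'S_n is pi 0, pi 1, ..., pi (n-1). *)

Definition ord_lt n : rel 'I_n := fun i j => i < j.

Definition cycle_max n (s : 'S_n) (m : 'I_n) : bool :=
  [forall j in porbit s m, j <= m].

(* [enum 'I_n] is increasing, and [fingraph.orbit s m] is the list m, s m, s (s m), ... *)
Definition std_cycles n (s : 'S_n) : seq (seq 'I_n) :=
  [seq fingraph.orbit s m | m <- enum 'I_n & cycle_max s m].

Definition theta_word n (s : 'S_n) : seq 'I_n := flatten (std_cycles s).

Section Fundamental.
Variable n : nat.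
Implicit Types s t : 'S_n.

Lemma mem_orbit_porbit s x y : (y \in fingraph.orbit s x) = (y \in porbit s x).
Proof.
rewrite -fconnect_orbit; apply/idP/porbitP => [/iter_findex <-|[i ->]].
  by exists (findex s x y); rewrite permX.
by rewrite permX fconnect_iter.
Qed.

Lemma cycle_maxP s x : exists2 m, cycle_max s m & x \in fingraph.orbit s m.
Proof.
have xx : x \in porbit s x by exact: porbit_id.
case: (arg_maxnP (fun j : 'I_n => j : nat) xx) => m mx mM.
have mx' : x \in porbit s m by rewrite porbit_sym; exact: mx.
exists m; last by rewrite mem_orbit_porbit.
apply/'forall_implyP => j jm; apply: mM.
by move: mx'; rewrite -eq_porbit_mem => /eqP E; change (j \in porbit s x); rewrite E.
Qed.

Lemma cycle_max_inj s m1 m2 x : cycle_max s m1 -> cycle_max s m2 ->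
  x \in porbit s m1 -> x \in porbit s m2 -> m1 = m2.
Proof.
move=> /'forall_implyP M1 /'forall_implyP M2.
rewrite -!eq_porbit_mem => /eqP E1 /eqP E2.
have E : porbit s m1 = porbit s m2 by rewrite -E1 -E2.
by apply/val_inj/eqP; rewrite eqn_leq M1 ?M2 // ?E ?porbit_id // -E porbit_id.
Qed.

Lemma theta_word_uniq s : uniq (theta_word s).
Proof.
rewrite /theta_word /std_cycles.
have : uniq [seq m <- enum 'I_n | cycle_max s m] by rewrite filter_uniq ?enum_uniq.
have : all (cycle_max s) [seq m <- enum 'I_n | cycle_max s m] by exact: filter_all.
elim: [seq _ <- _ | _] => //= m r IH /andP[mM rM] /andP[mr ru].
rewrite cat_uniq IH // andbT (orbit_uniq s m) /=.
apply/hasPn => x /flatten_mapP[m' m'r]; apply: contraL => xm.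
apply/negP => xm'; case/negP: mr.
rewrite (@cycle_max_inj s m m' x) -?mem_orbit_porbit //.
exact: (allP rM).
Qed.

Lemma mem_theta_word s x : x \in theta_word s.
Proof.
have [m mM xm] := cycle_maxP s x.
by apply/flatten_mapP; exists m => //; rewrite mem_filter mM mem_enum.
Qed.

Lemma size_theta_word s : size (theta_word s) = n.
Proof.
rewrite -(card_uniqP (theta_word_uniq s)) -[RHS]card_ord.
by apply: eq_card => x; rewrite mem_theta_word.
Qed.

Lemma theta_subproof s : injective (fun i : 'I_n => nth i (theta_word s) i).
Proof.
move=> i j /eqP E; apply/val_inj/eqP.
rewrite (set_nth_default i j) ?size_theta_word // in E.
by rewrite nth_uniq ?size_theta_word ?theta_word_uniq in E.
Qed.

Definition theta s : 'S_n := perm (@theta_subproof s).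

Lemma nth_theta_word s x0 (i : 'I_n) : nth x0 (theta_word s) i = theta s i.
Proof. by rewrite permE; apply: set_nth_default; rewrite size_theta_word. Qed.

(* The cycles are recovered from the word: a block consists of its first letter
   m and of letters smaller than m, and the next block starts above m. *)
Definition block_of (m : 'I_n) (c : seq 'I_n) : bool :=
  if c is m' :: r then (m' == m) && all (fun x : 'I_n => x < m) r else false.

Lemma find_block (f : 'I_n -> seq 'I_n) (m : 'I_n) r ms :
    {in ms, forall m', block_of m' (f m')} -> all (ord_lt m) ms ->
    all (fun x : 'I_n => x < m) r ->
  find (fun x : 'I_n => m <= x) (r ++ flatten (map f ms)) = size r.
Proof.
move=> fB mms rm; rewrite find_cat.
have -> : has (fun x : 'I_n => m <= x) r = false.
  by apply/hasPn => x /(allP rm); rewrite -ltnNge.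
case: ms fB mms => [|m' ms] fB /=; first by rewrite addn0.
case/andP => mm' _; have := fB m' (mem_head _ _).
case: (f m') => //= x q /andP[/eqP -> _].
by rewrite (ltnW mm') addn0.
Qed.

Lemma blocks_inj (f g : 'I_n -> seq 'I_n) ms ks :
    {in ms, forall m, block_of m (f m)} -> {in ks, forall m, block_of m (g m)} ->
    pairwise (@ord_lt n) ms -> pairwise (@ord_lt n) ks ->
  flatten (map f ms) = flatten (map g ks) ->
  ms = ks /\ {in ms, f =1 g}.
Proof.
elim: ms ks => [|m ms IH] [|k ks] fB gB //=.
- by have := gB k (mem_head _ _); case: (g k).
- by have := fB m (mem_head _ _); case: (f m).
have fB' : {in ms, forall m, block_of m (f m)}.
  by move=> x xm; apply: fB; rewrite inE xm orbT.
have gB' : {in ks, forall m, block_of m (g m)}.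
  by move=> x xm; apply: gB; rewrite inE xm orbT.
case/andP => mms pms /andP[kks pks].
have := fB m (mem_head _ _); have := gB k (mem_head _ _).
case Ef: (f m) => [//|m' r]; case Eg: (g k) => [//|k' q] /=.
case/andP => /eqP Ek qk /andP[/eqP Em rm] [mk E].
subst m' k' k; have Er := find_block fB' mms rm; have Eq := find_block gB' kks qk.
have sz : size r = size q by rewrite -Er -Eq E.
move/eqP: E; rewrite eqseq_cat // => /andP[/eqP rq /eqP E].
have [<- fg] := IH ks fB' gB' pms pks E; split=> // x.
by rewrite inE => /predU1P[->|/fg //]; rewrite Ef Eg rq.
Qed.

Lemma orbit_block s m : cycle_max s m -> block_of m (fingraph.orbit s m).
Proof.
move=> /'forall_implyP mM; have := orbit_uniq s m.
have E y := mem_orbit_porbit s m y.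
move: E; rewrite /fingraph.orbit -orderSpred /= eqxx => E /andP[mr _].
apply/allP => y yr; rewrite ltn_neqAle mM ?andbT -?E ?inE ?yr ?orbT //.
by apply: contraNneq mr => /val_inj ym; rewrite -{1}ym.
Qed.

Lemma theta_inj : injective theta.
Proof.
move=> s t st.
have W : theta_word s = theta_word t.
  have [x0 _|n0] := pickP (predT : pred 'I_n); last first.
    have no (u : seq 'I_n) : u = [::] by case: u => [//|x u]; have := n0 x.
    by rewrite (no (theta_word s)) (no (theta_word t)).
  apply: (@eq_from_nth _ x0) => [|i]; rewrite !size_theta_word // => ltin.
  by rewrite -[i]/(val (Ordinal ltin)) !nth_theta_word st.
have P u : pairwise (@ord_lt n) [seq m <- enum 'I_n | cycle_max u m].
  have : pairwise (@ord_lt n) (enum 'I_n).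
    have E : pairwise ltn (map val (enum 'I_n)).
      by rewrite val_enum_ord -(sorted_pairwise ltn_trans) iota_ltn_sorted.
    by rewrite pairwise_map in E.
  exact: pairwise_filter.
have B u : {in [seq m <- enum 'I_n | cycle_max u m],
    forall m, block_of m (fingraph.orbit u m)}.
  by move=> m; rewrite mem_filter => /andP[/orbit_block].
have [_ EO] := blocks_inj (B s) (B t) (P s) (P t) W.
apply/permP => x; have [m mM xm] := cycle_maxP s x.
have Om : fingraph.orbit s m = fingraph.orbit t m.
  by apply: EO; rewrite mem_filter mM mem_enum.
have /eqP -> := next_cycle (cycle_orbit (@perm_inj _ s) m) xm.
by rewrite Om; apply/esym/eqP/(next_cycle (cycle_orbit (@perm_inj _ t) m)); rewrite -Om.
Qed.

End Fundamental.

Definition hat n : 'S_n -> 'S_n := invF (@theta_inj n).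

Lemma hatK n : cancel (@hat n) (@theta n).
Proof. exact: f_invF. Qed.

Lemma thetaK n : cancel (@theta n) (@hat n).
Proof. exact: invF_f. Qed.

Record arrow_pattern (k : nat) := ArrowPattern {
  ap_word : seq 'I_k;
  ap_arrows : seq ('I_k * 'I_k);
  ap_onto : forall i : 'I_k,
    i \in ap_word ++ map fst ap_arrows ++ map snd ap_arrows
}.

(* x lists the elements of X in increasing order, t the positions. *)
Definition contains k (p : arrow_pattern k) n (pi : 'S_n) : bool :=
  [exists x : k.-tuple 'I_n, exists t : (size (ap_word p)).-tuple 'I_n,
    [&& sorted (@ord_lt n) x, sorted (@ord_lt n) t,
        [seq pi i | i <- t] == [seq tnth x a | a <- ap_word p]
      & all (fun e => hat pi (tnth x e.1) == tnth x e.2) (ap_arrows p)]].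

Definition avoid_count k (p : arrow_pattern k) (n : nat) : nat :=
  #|[set pi : 'S_n | ~~ contains p pi]|.

Definition derangements (n : nat) : nat :=
  #|[set s : 'S_n | [forall i, s i != i]]|.

(* So the truncated subtraction n`! - derangements n is a true difference. *)
Lemma leq_derangements n : derangements n <= n`!.
Proof. by rewrite -(card_Sn n); apply: max_card. Qed.

Definition word_12 : seq 'I_2 := [:: ord0; ord_max].
Definition arrows_22 : seq ('I_2 * 'I_2) := [:: (ord_max, ord_max)].

Lemma pat_12_22_onto (i : 'I_2) :
  i \in word_12 ++ map fst arrows_22 ++ map snd arrows_22.
Proof. by case: i => -[|[|]] //= ltk; rewrite !inE -!val_eqE. Qed.

(* (12; 2 -> 2): the letters 1 and 2 are [ord0] and [ord_max] in 'I_2. *)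
Definition pat_12_22 : arrow_pattern 2 := ArrowPattern pat_12_22_onto.

(* Main.v *)
(* Let N_b(n), resp. M_b(n), count the permutations of [n] in which no 0-indexed
   position i >= b is a record followed by a record or by the end of the word,
   resp. by a record.  Fixed points of s are exactly the 1-letter blocks of its
   standard cycle form, so derangements are counted by N_0; since every letter
   before a 1-letter block is smaller than it, avoiders are counted by N_1.
   The last letter is a record for just one of its n + 1 possible relative
   values, whence
     N_b(n+1) = n M_b(n)  and  M_b(n+1) = N_b(n) + n M_b(n).
   By induction N_0(n) + N_1(n) = n! and n (M_0(n) + M_1(n)) = (n+1)!. *)
Require Import Defs.
From mathcomp Require Import all_boot perm zify.
Set Implicit Arguments.
Unset Strict Implicit.
Unset Printing Implicit Defensive.

(** * Records, and fixed points as one-letter blocks *)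

Definition is_record n (p : 'S_n) (i : 'I_n) : bool :=
  [forall j : 'I_n, (j < i) ==> (p j < p i)].

Lemma recordP n (p : 'S_n) (i : 'I_n) :
  reflect (forall j : 'I_n, j < i -> p j < p i) (is_record p i).
Proof. exact: 'forall_implyP. Qed.

(** The second conjunct is vacuous at the last position, so a record ending the word counts. *)
Definition singleton_block n (p : 'S_n) (i : 'I_n) : bool :=
  is_record p i && [forall j : 'I_n, (j == i.+1 :> nat) ==> is_record p j].

Lemma singleton_blockP n (p : 'S_n) (i : 'I_n) :
  reflect (is_record p i /\ forall j : 'I_n, j = i.+1 :> nat -> is_record p j)
          (singleton_block p i).
Proof.
apply: (iffP andP) => -[-> H]; split=> //.
  by move=> j /eqP; apply/implyP/(forallP H).
by apply/forallP => j; apply/implyP => /eqP /H.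
Qed.

(** Cycle maxima are listed increasingly: every letter of an earlier block is at most that block's
    maximum, hence below [m], and the next block, if any, opens with a larger maximum. *)
Lemma theta_word_split n (s : 'S_n) m : cycle_max s m ->
  exists u v, [/\ theta_word s = u ++ fingraph.orbit s m ++ v,
    forall x, x \in u -> x < m
    & forall x, ohead v = Some x -> m < x].
Proof.
move=> mM; rewrite /theta_word /std_cycles.
have m_in : m \in [seq k <- enum 'I_n | cycle_max s k] by rewrite mem_filter mM mem_enum.
have : pairwise (@ord_lt n) [seq k <- enum 'I_n | cycle_max s k].
  apply: pairwise_filter.
  have : pairwise ltn (map val (enum 'I_n)).
    by rewrite val_enum_ord -(sorted_pairwise ltn_trans) iota_ltn_sorted.
  by rewrite pairwise_map.
have : all (cycle_max s) [seq k <- enum 'I_n | cycle_max s k] by exact: filter_all.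
case/splitPr: m_in => ks ls.
rewrite all_cat pairwise_cat /= => /and3P[kM _ lM].
case/and4P=> /allrelP kl _ ml _.
exists (flatten [seq fingraph.orbit s k | k <- ks]).
exists (flatten [seq fingraph.orbit s k | k <- ls]).
split; first by rewrite map_cat flatten_cat.
- move=> x /flatten_mapP[k kks]; rewrite mem_orbit_porbit => xk.
  apply: leq_ltn_trans (kl k m kks (mem_head _ _)).
  by have /'forall_implyP := allP kM _ kks; apply.
- move=> x; case: ls ml lM {kl} => [//|k ls] /= /andP[mk _] /andP[kM' _].
  have := orbit_block kM'; case: (fingraph.orbit s k) => //= y r /andP[/eqP -> _].
  by case=> <-.
Qed.

Lemma singleton_block_theta n (s : 'S_n) (i : 'I_n) :
  singleton_block (theta s) i = (s (theta s i) == theta s i).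
Proof.
have sz := size_theta_word s.
have [m mM] := cycle_maxP s (theta s i).
have [u [v [wE um vm]]] := theta_word_split mM.
have iw : index (theta s i) (theta_word s) = i.
  by rewrite -(nth_theta_word s i) index_uniq ?sz ?theta_word_uniq.
have := orbit_block mM; case oE: (fingraph.orbit s m) => [//|m' r].
case/andP=> /eqP Em rm; subst m' => y_in.
have ltu : size u < n by have := sz; rewrite wE oE !size_cat /=; lia.
have nthE (k : 'I_n) : theta s k = nth m (u ++ (m :: r) ++ v) k.
  by rewrite -(nth_theta_word s m) wE oE.
have um_pos : theta s (Ordinal ltu) = m by rewrite nthE nth_cat ltnn subnn.
apply/singleton_blockP/eqP => [[irec inext]|fix_i].
  (* A letter of the tail [r] is smaller than [m], which precedes it, so it is no record. *)
  have Ei : theta s i = m.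
    move: y_in; rewrite inE => /predU1P[//|y_r].
    have ym := allP rm _ y_r.
    have ui : size u < i.
      have y_u : theta s i \notin u.
        have := theta_word_uniq s; rewrite wE oE cat_uniq => /and3P[_ /hasPn H _].
        by apply: H; rewrite mem_cat inE y_r orbT.
      rewrite -iw wE oE index_cat (negPf y_u) /= ifN ?addnS ?ltnS ?leq_addr //.
      by apply: contraTneq ym => <-; rewrite ltnn.
    have := recordP _ _ irec (Ordinal ltu) ui.
    by rewrite um_pos => my; move: (ltn_trans my ym); rewrite ltnn.
  have Eu : i = Ordinal ltu by apply: (@perm_inj _ (theta s)); rewrite um_pos.
  (* Otherwise the letter right after [m] is some [z] below [m], while [inext] makes it a record. *)
  have r0 : r = [::].
    case: r rm oE nthE {y_in} => [//|z r] /= /andP[zm _] oE nthE.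
    have ltu1 : (size u).+1 < n by have := sz; rewrite wE oE !size_cat /=; lia.
    have := inext (Ordinal ltu1); rewrite Eu => /(_ erefl) /recordP.
    move/(_ (Ordinal ltu) (ltnSn _)); rewrite um_pos nthE nth_cat /=.
    rewrite [(size u).+1 < _]ltnNge leqnSn subSnn /= => mz.
    by move: (ltn_trans mz zm); rewrite ltnn.
  have := next_cycle (cycle_orbit (@perm_inj _ s) m); rewrite oE r0 => /(_ m).
  by rewrite /= !inE eqxx Ei => /(_ isT) /eqP.
have i_max : cycle_max s (theta s i).
  apply/'forall_implyP => j; rewrite -mem_orbit_porbit -fconnect_orbit.
  by move=> /iter_findex <-; rewrite iter_fix.
have Ei : theta s i = m.
  apply: (cycle_max_inj i_max mM (porbit_id _ _)).
  by rewrite -mem_orbit_porbit oE.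
have r0 : r = [::].
  case: r oE {rm y_in wE nthE ltu um_pos} => [//|z r] oE.
  have := next_cycle (cycle_orbit (@perm_inj _ s) m); rewrite oE => /(_ m).
  rewrite /= !inE eqxx -Ei fix_i => /(_ isT) /eqP zE.
  by have := orbit_uniq s m; rewrite oE /= inE -Ei zE eqxx.
have Eu : i = Ordinal ltu by apply: (@perm_inj _ (theta s)); rewrite um_pos.
have before (j : 'I_n) : j < size u -> theta s j < m.
  by move=> ju; rewrite nthE nth_cat ju; apply: um; apply: mem_nth.
rewrite Eu; split=> [|j /= jE]; apply/recordP => k /=.
  by rewrite um_pos; apply: before.
(* As [r] is empty, position [size u + 1] holds the head of [v]. *)
have mj : m < theta s j.
  have := ltn_ord j; rewrite nthE jE => jn; have := sz; rewrite wE oE r0 !size_cat /= => sz'.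
  have jv : 0 < size v by rewrite -[X in _ < X]sz' addnA addn1 -[X in X < _]addn0 ltn_add2l in jn.
  rewrite nth_cat [(size u).+1 < _]ltnNge leqnSn subSnn /=; apply: vm.
  by case: (v) jv.
rewrite jE ltnS leq_eqVlt => /predU1P[ku|/before km]; last exact: ltn_trans mj.
by have -> : k = Ordinal ltu; [exact: val_inj | rewrite um_pos].
Qed.

(** * Effect of a new last letter on the two conditions *)

Definition no_singleton b n (p : 'S_n) : bool :=
  [forall i : 'I_n, (b <= i) ==> ~~ singleton_block p i].

Definition no_adjacent b n (p : 'S_n) : bool :=
  [forall i : 'I_n, forall j : 'I_n,
     (b <= i) && (j == i.+1 :> nat) ==> ~~ (is_record p i && is_record p j)].

Lemma no_adjacentP b n (p : 'S_n) :
  reflect (forall i j : 'I_n, b <= i -> j = i.+1 :> nat ->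
             is_record p i -> is_record p j -> False) (no_adjacent b p).
Proof.
apply: (iffP forallP) => [H i j bi /eqP ij ri rj | H i].
  by have /forallP/(_ j) := H i; rewrite bi ij ri rj.
apply/forallP => j; apply/implyP => /andP[bi /eqP ij].
by apply/negP => /andP[ri rj]; apply: (H i j).
Qed.

Lemma no_singletonP b n (p : 'S_n) :
  reflect (forall i : 'I_n, b <= i -> ~ singleton_block p i) (no_singleton b p).
Proof.
by apply: (iffP 'forall_implyP) => H i /H /negP.
Qed.

(** The new last letter is [v]; letters of [p] that are at least [v] move up by one, which keeps
    their relative order. *)
Definition append_last n (v : 'I_n.+1) (p : 'S_n) := lift_perm ord_max v p.

Lemma record_append_lift n v (p : 'S_n) i :
  is_record (append_last v p) (lift ord_max i) = is_record p i.
Proof.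
have mono (a b : 'I_n) : (lift v a < lift v b) = (a < b).
  by rewrite /= /bump; lia.
apply/recordP/recordP => H j.
  by move=> ji; have := H (lift ord_max j); rewrite !lift_perm_lift mono !lift_max; apply.
case: (unliftP ord_max j) => [k|] ->; rewrite !lift_max.
  by move=> ki; rewrite !lift_perm_lift mono H.
by rewrite ltnNge ltnW.
Qed.

Lemma record_append_max n v (p : 'S_n) :
  is_record (append_last v p) ord_max = (v == ord_max).
Proof.
apply/recordP/eqP => [H|-> j].
  have [//|vn] := eqVneq v ord_max; exfalso.
  (* If [v] is not the largest value, that value sits at an earlier position and beats the last
     letter. *)
  have /H : (append_last v p)^-1%g ord_max < (ord_max : 'I_n.+1).
    rewrite ltn_neqAle -ltnS ltn_ord andbT; apply: contra vn => /eqP/val_inj E.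
    by apply/eqP; rewrite -[LHS](lift_perm_id ord_max v p) -[X in lift_perm _ _ _ X]E permKV.
  by rewrite permKV lift_perm_id ltnNge -ltnS ltn_ord.
case: (unliftP ord_max j) => [k|] ->; last by rewrite ltnn.
by rewrite lift_perm_lift lift_perm_id !lift_max /= ltn_ord.
Qed.

(** A largest last letter is itself a one-letter block, at position [n], which is tested since
    [b <= n]. With any other last letter, the word ends in a non-record, so only pairs of adjacent
    records inside [p] matter. *)
Lemma no_singleton_append b n v (p : 'S_n) : b <= n ->
  no_singleton b (append_last v p) = (v != ord_max) && no_adjacent b p.
Proof.
move=> bn; apply/no_singletonP/andP => [H|[vn /no_adjacentP H] i bi].
  split.
    apply/negP => vn; apply: (H ord_max bn); apply/singleton_blockP.
    by rewrite record_append_max; split=> // j /= jn; have := ltn_ord j; rewrite jn ltnn.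
  apply/no_adjacentP => i j bi ji ri rj; apply: (H (lift ord_max i)).
    by rewrite lift_max.
  apply/singleton_blockP; rewrite record_append_lift; split=> // k.
  rewrite lift_max => ki; suff -> : k = lift ord_max j by rewrite record_append_lift.
  by apply: ord_inj; rewrite lift_max ki ji.
case/singleton_blockP; case: (unliftP ord_max i) bi => [k|] ->; last first.
  by rewrite record_append_max (negPf vn).
rewrite lift_max record_append_lift => bk rk next.
have [kn|kn] := ltnP k.+1 n.
  apply: (H k (Ordinal kn)) => //.
  by rewrite -(record_append_lift v); apply: next; rewrite lift_max.
have := next ord_max; rewrite record_append_max (negPf vn) => /(_ _)/notF; apply.
by apply/eqP; rewrite eqn_leq kn /= ltn_ord.
Qed.

(** A largest last letter is a record following the end of [p], so a final record of [p] becomes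
    forbidden too; any other last letter creates no new pair. *)
Lemma no_adjacent_append b n v (p : 'S_n) :
  no_adjacent b (append_last v p) =
    if v == ord_max then no_singleton b p else no_adjacent b p.
Proof.
have [vn|vn] := boolP (v == ord_max).
  apply/no_adjacentP/no_singletonP => [H i bi /singleton_blockP[ri next]|H i j].
    have [lt_in|le_ni] := ltnP i.+1 n.
      apply: (H (lift ord_max i) (lift ord_max (Ordinal lt_in)));
        rewrite ?lift_max ?record_append_lift //.
      exact: next.
    apply: (H (lift ord_max i) ord_max);
      rewrite ?lift_max ?record_append_lift ?record_append_max //.
    by apply/eqP; rewrite eqn_leq le_ni /= ltn_ord.
  case: (unliftP ord_max i) => [k|] ->; last first.
    by move=> _ /= jn; have := ltn_ord j; rewrite jn ltnn.
  rewrite lift_max record_append_lift => bk jk rk rj.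
  apply: (H k bk); apply/singleton_blockP; split=> // l lk.
  rewrite -(record_append_lift v); suff -> : lift ord_max l = j by [].
  by apply: ord_inj; rewrite lift_max lk jk.
apply/no_adjacentP/no_adjacentP => [H i j bi ji ri rj|H i j].
  by apply: (H (lift ord_max i) (lift ord_max j));
    rewrite ?lift_max ?record_append_lift.
case: (unliftP ord_max j) => [l|] ->; last by rewrite record_append_max (negPf vn).
case: (unliftP ord_max i) => [k|] ->; rewrite !lift_max.
  by rewrite !record_append_lift; apply: H.
by move=> _ /= E; have := ltn_ord l; rewrite E; lia.
Qed.

(** Both [v] and [p] can be read off [append_last v p], and (n+1) n! = (n+1)! turns injectivity into
    bijectivity. *)
Lemma card_append n (P : pred 'S_n.+1) :
  #|[set p | P p]| = \sum_(v : 'I_n.+1) #|[set p | P (append_last v p)]|.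
Proof.
pose f (vp : 'I_n.+1 * 'S_n) := append_last vp.1 vp.2.
have f_inj : injective f.
  move=> [v p] [w q]; rewrite /f /= => E.
  have Ev : v = w by rewrite -(lift_perm_id ord_max v p) -[lift_perm _ _ _]/(append_last v p) E lift_perm_id.
  subst w; congr pair; apply/permP => i; apply: (@lift_inj _ v).
  by rewrite -!(lift_perm_lift ord_max) -[lift_perm _ _ _]/(append_last v p) E.
have f_bij : bijective f.
  by apply: inj_card_bij => //; rewrite card_prod card_ord !card_Sn -factS.
rewrite -sum1_card (reindex f) /=; last exact: onW_bij.
under [RHS]eq_bigr => v _ do rewrite -sum1_card.
rewrite pair_big_dep /=; apply: eq_bigl => -[v p]; by rewrite !inE.
Qed.

(** * Recurrences for N_b ([count_no_singleton b]) and M_b ([count_no_adjacent b]) *)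

Definition count_no_singleton b n := #|[set p : 'S_n | no_singleton b p]|.
Definition count_no_adjacent b n := #|[set p : 'S_n | no_adjacent b p]|.

Lemma count_no_singletonS b n : b <= n ->
  count_no_singleton b n.+1 = n * count_no_adjacent b n.
Proof.
move=> bn; rewrite /count_no_singleton card_append (bigD1 ord_max) //=.
rewrite (eq_card0 (A := [set p | _])) ?add0n; last first.
  by move=> p; rewrite inE no_singleton_append ?eqxx.
rewrite (eq_bigr (fun=> count_no_adjacent b n)); last first.
  move=> v vn; apply: eq_card => p; by rewrite !inE no_singleton_append ?vn.
by rewrite sum_nat_const cardC1 card_ord.
Qed.

Lemma count_no_adjacentS b n :
  count_no_adjacent b n.+1 = count_no_singleton b n + n * count_no_adjacent b n.
Proof.
rewrite /count_no_adjacent card_append (bigD1 ord_max) //=; congr addn.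
  by apply: eq_card => p; rewrite !inE no_adjacent_append eqxx.
rewrite (eq_bigr (fun=> count_no_adjacent b n)); last first.
  move=> v vn; apply: eq_card => p; by rewrite !inE no_adjacent_append (negPf vn).
by rewrite sum_nat_const cardC1 card_ord.
Qed.

Lemma count_no_singleton_add n :
  count_no_singleton 0 n.+1 + count_no_singleton 1 n.+1 = n.+1`! /\
  n.+1 * (count_no_adjacent 0 n.+1 + count_no_adjacent 1 n.+1) = n.+2`!.
Proof.
have card_all m (P : pred 'S_m) : (forall p, P p) -> #|[set p | P p]| = m`!.
  by move=> allP; rewrite -card_Sn; apply: eq_card => p; rewrite !inE allP.
have all_no b p : no_adjacent b (p : 'S_0) by apply/no_adjacentP => -[].
have all_ns b p : no_singleton b (p : 'S_0) by apply/no_singletonP => -[].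
have all_n1 p : no_singleton 1 (p : 'S_1) by apply/no_singletonP => -[[]].
have c0 b : count_no_adjacent b 0 = 1.
  by apply: card_all; exact: all_no.
have s0 b : count_no_singleton b 0 = 1.
  by apply: card_all; exact: all_ns.
(* Computed directly: the recurrence for N_1 requires 1 <= n, so it first yields N_1(2). *)
have s1 : count_no_singleton 1 1 = 1.
  by apply: card_all; exact: all_n1.
elim: n => [|n [IHs IHa]].
  by rewrite !count_no_adjacentS !s0 !c0 s1 count_no_singletonS.
rewrite !count_no_singletonS // -mulnDr IHa; split=> //.
(* The sum M_0 + M_1 at n+2 is (n+1)! + (n+2)! = (n+3) (n+1)!. *)
rewrite !(count_no_adjacentS _ n.+1) addnACA -mulnDr IHs IHa.
by rewrite !factS; lia.
Qed.

(** * Derangements and avoiders as N_0 and N_1 *)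

Lemma derangementsE n : derangements n = count_no_singleton 0 n.
Proof.
rewrite /count_no_singleton -(card_preimset _ (@theta_inj n)).
apply: eq_card => s; rewrite !inE; apply/forallP/no_singletonP => H i.
  by rewrite singleton_block_theta => _; apply/negP.
have := H ((theta s)^-1%g i) isT; rewrite singleton_block_theta permKV.
by move/negP.
Qed.

Lemma contains_12_22 n (p : 'S_n) :
  contains pat_12_22 p = ~~ no_singleton 1 p.
Proof.
have blockE i : singleton_block p i = (hat p (p i) == p i).
  by rewrite -{1}(hatK p) singleton_block_theta hatK.
apply/existsP/idP => [[x /existsP[t /and4P[_ st /eqP pE /andP[/= hE _]]]]|].
  (* The letter 2 sits at [t1], which is at least 1 because [t0] precedes it. *)
  case: t st pE => -[|t0 [|t1 []]] //= t_sz /andP[lt_t _] [_ pt].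
  apply/negP => /no_singletonP/(_ t1 (leq_trans (ltn0Sn _) lt_t)); apply.
  by rewrite blockE pt.
case/forallPn => i; rewrite negb_imply negbK => /andP[i_gt0 bi].
(* The first position can play the letter 1: the record at [i] exceeds every earlier letter. *)
pose z := Ordinal (leq_trans (ltn0Sn _) (ltn_ord i)).
have /singleton_blockP[/recordP/(_ z i_gt0) lt_p _] := bi.
exists [tuple p z; p i]; apply/existsP; exists [tuple z; i].
rewrite /= /ord_lt /= lt_p i_gt0 !(tnth_nth (p i)) /= eqxx /=.
by rewrite andbT -blockE.
Qed.

Theorem theorem3p2 (n : nat) (hn : 1 <= n) :
  avoid_count pat_12_22 n = n`! - derangements n.
Proof.
case: n hn => // n _; have [<- _] := count_no_singleton_add n.
rewrite derangementsE addKn; apply: eq_card => p.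
by rewrite !inE contains_12_22 negbK.
Qed.
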